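(* Let $\Pi$ be a Bieberbach group in a Euclidean affine space $\mathcal{E}$ of dimension $n\ge2$ with translation vector space $\mathcal{V}$, lattice subgroup $L$ and holonomy group $H$. Let $\mathcal{V}',\mathcal{V}''$ be two nonzero proper $H$-invariant $L$-subspaces of $\mathcal{V}$, complementary to each other in the sense that $\mathcal{V}=\mathcal{V}'\oplus\mathcal{V}''$. Fix generic cosets $\mathcal{E}'$ of $\mathcal{V}'$ and $\mathcal{E}''$ of $\mathcal{V}''$ in $\mathcal{E}$, and let $\Pi',\Pi''\subseteq\Pi$, $L',L''\subseteq L$ and $H',H''\subseteq H$ be the associated subgroups (described in the context), with the quotient groups $\hat\Pi=\Pi/(\Pi'\Pi'')$, $\hat L=L/(L'L'')$, $\hat H=H/(H'H'')$. Let $\mathcal{M}',\mathcal{M}''$ be the images of $\mathcal{E}',\mathcal{E}''$ under the covering projection $\mathrm{pr}:\mathcal{E}\to\mathcal{M}=\mathcal{E}/\Pi$, and let $\mathcal{T}'=\mathcal{E}'/L'$, $\mathcal{T}''=\mathcal{E}''/L''$ be the tori contained in the torus $\mathcal{T}=\mathcal{E}/L$ (as the images of $\mathcal{E}',\mathcal{E}''$ under the projection $\mathcal{E}\to\mathcal{T}$). Then: (a) $\mathcal{M}'\cap\mathcal{M}''$, or $\mathcal{T}'\cap\mathcal{T}''$, is a finite subset of $\mathcal{M}$, or $\mathcal{T}$, and stands in a bijective correspondence with the quotient group $\hat\Pi$ or, respectively, $\hat L$. (b) The projection $\mathcal{T}\to\mathcal{M}$ maps $\mathcal{T}'\cap\mathcal{T}''$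 injectively into $\mathcal{M}'\cap\mathcal{M}''$. (c) The cardinality $|\mathcal{M}'\cap\mathcal{M}''|$ of $\mathcal{M}'\cap\mathcal{M}''$ equals $|\mathcal{T}'\cap\mathcal{T}''|$ times $|\hat H|$. (d) The claim about $\mathcal{T}'\cap\mathcal{T}''$ in (a) remains true whether or not $\mathcal{E}',\mathcal{E}''$ are generic. (e) The two bijective correspondences in (a) may be chosen so that, under the resulting identifications, the injective mapping $\mathcal{T}'\cap\mathcal{T}''\to\mathcal{M}'\cap\mathcal{M}''$ of (b) coincides with the group homomorphism $\hat L\to\hat\Pi$ induced by the inclusion $L\to\Pi$.
   Context: A Euclidean affine space $\mathcal{E}$ is a finite-dimensional real affine space whose translation vector space $\mathcal{V}$ carries an inner product. A Bieberbach group in $\mathcal{E}$ is a torsion-free discrete subgroup $\Pi$ of the isometry group $\mathrm{Iso}\,\mathcal{E}$ for which there exists a compact fundamental domain (a compact set intersecting all orbits). Its lattice subgroup is $L=\Pi\cap\mathcal{V}$ (all translations in $\Pi$), a full lattice in $\mathcal{V}$, and its holonomy group $H\subseteq\mathrm{Iso}\,\mathcal{V}$ is the finite group of linear parts of elements of $\Pi$. $\Pi$ acts freely on $\mathcal{E}$, $\mathcal{M}=\mathcal{E}/\Pi$ is a compact flat Riemannian manifold, and the quotient projection $\mathrm{pr}:\mathcal{E}\to\mathcal{M}$ is the composition of covering projections $\mathcal{E}\to\mathcal{T}=\mathcal{E}/L\to\mathcal{M}=\mathcal{T}/H$, where $H\cong\Pi/L$ acts freely on $\mathcal{T}$. A vector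 subspace $\mathcal{V}'\subseteq\mathcal{V}$ is an $L$-subspace if it is spanned by $L\cap\mathcal{V}'$. A coset of $\mathcal{V}'$ in $\mathcal{E}$ is an orbit of the translational action of $\mathcal{V}'$; $\mathcal{E}/\mathcal{V}'$ is the Euclidean affine space of all such cosets. If $\mathcal{V}'$ is $H$-invariant, $\Pi$ acts isometrically on $\mathcal{E}/\mathcal{V}'$; a coset $\mathcal{E}'$ is generic if its stabilizer group $\{\gamma\in\Pi:\gamma(\mathcal{E}')=\mathcal{E}'\}$ equals the kernel $\Sigma'$ of the homomorphism $\Pi\to\mathrm{Iso}\,[\mathcal{E}/\mathcal{V}']$. Subgroups associated with $\mathcal{V}'$ (and analogously, with double primes, with $\mathcal{V}''$): for a generic coset $\mathcal{E}'$ of $\mathcal{V}'$, restriction to $\mathcal{E}'$ maps $\Sigma'$ isomorphically onto a Bieberbach group $\Pi'$ in $\mathcal{E}'$ with $\mathcal{M}'=\mathcal{E}'/\Pi'$, and one identifies $\Pi'$ with the normal subgroup $\Sigma'$ of $\Pi$. The lattice subgroup of $\Pi'$ is $L'=L\cap\mathcal{V}'$. Let $K'\subseteq H$ be the normal subgroup consisting of all elements of $H$ that act as the identity on the orthogonal complement of $\mathcal{V}'$ in $\mathcal{V}$. The holonomy group $H'$ of $\Pi'$ is taken to be the image of $K'$ under the injective homomorphism of restriction to $\mathcal{V}'$, and it is treated as a subgroup of $H$ by identifying it with $K'$ via this restriction isomorphism; thus, as subgroups of $H$, $H'=K'$ and $H''=K''$. The sets of products $\Pi'\Pi''$, $L'L''$,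 $H'H''$ are normal subgroups of $\Pi$, $L$ and $H$, respectively.
   Formalization: In (c), H' and H'' are the groups of linear parts of Π' and Π'' rather than K' and K'' (elements of H that are the identity on the orthogonal complement); with K', K'' the formula fails for the Klein bottle, and it is also stated for K', K'' when these coincide with H', H''. *)

(* Defs.v *)
From HB Require Import structures.
From mathcomp Require Import all_boot all_order all_algebra sesquilinear finmap.
From mathcomp Require Import all_classical all_reals topology.
From mathcomp Require Import ring lra.

Set Implicit Arguments.
Unset Strict Implicit.
Unset Printing Implicit Defensive.

Import Order.TTheory GRing.Theory Num.Theory.

Local Open Scope classical_set_scope.
Local Open Scope ring_scope.

(* [translate] is the simply transitive action of the translation space;
   [vec x y] is the unique vector that carries [x] to [y]. *)
Record euclideanAffine (R : realType) := EuclideanAffine {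
  tvect : vectType R ;
  inner : {dot tvect for @idfun R} ;
  points :> Type ;
  origin : points ;
  translate : tvect -> points -> points ;
  vec : points -> points -> tvect ;
  translate0 : forall x, translate 0 x = x ;
  translateD : forall u v x, translate (u + v) x = translate u (translate v x) ;
  translate_vec : forall x y, translate (vec x y) x = y ;
  vec_translate : forall v x, vec x (translate v x) = v }.

Section Metric.
Context {R : realType} (E : euclideanAffine R).
Local Notation "''[' u , v ]" := (inner E u v) : ring_scope.

Definition edist (x y : E) : R := Num.sqrt '[vec x y, vec x y].

Let innerC (u v : tvect E) : '[u, v] = '[v, u].
Proof. by have := hermC (inner E) u v; rewrite expr0 mul1r. Qed.

Let inner_ge0 (u : tvect E) : 0 <= '[u, u].
Proof.
have [->|u0] := eqVneq u 0; first by rewrite linear0r.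
exact/ltW/(neq0_dnorm_gt0 u u0).
Qed.

Let inner_eq0 (u : tvect E) : '[u, u] = 0 -> u = 0.
Proof.
move=> uu0; apply/eqP; apply: contraT => u0.
by have := neq0_dnorm_gt0 (s := inner E) u u0; rewrite uu0 ltxx.
Qed.

Let inner_sqD (u v : tvect E) :
  '[u + v, u + v] = '[u, u] + '[u, v] *+ 2 + '[v, v].
Proof. by rewrite linearDl/= !linearDr/= (innerC v u) mulr2n !addrA. Qed.

Let inner_sqZ (a b : R) (u v : tvect E) :
  '[a *: u + b *: v, a *: u + b *: v] =
  a ^+ 2 * '[u, u] + (a * b * '[u, v]) *+ 2 + b ^+ 2 * '[v, v].
Proof.
by rewrite inner_sqD !linearZl_LR !linearZr_LR/= !mulrA.
Qed.

Let cauchy_schwarz (u v : tvect E) :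
  '[u, v] <= Num.sqrt '[u, u] * Num.sqrt '[v, v].
Proof.
rewrite -sqrtrM//.
have [v0|v0] := eqVneq '[v, v] 0.
  have -> : v = 0 by apply: inner_eq0.
  by rewrite !linear0r mulr0 sqrtr0.
have vgt0 : 0 < '[v, v] by rewrite lt_def v0 inner_ge0.
have := inner_ge0 ('[v, v] *: u + (- '[u, v]) *: v).
rewrite inner_sqZ.
have -> : '[v, v] ^+ 2 * '[u, u] + ('[v, v] * - '[u, v] * '[u, v]) *+ 2 +
   (- '[u, v]) ^+ 2 * '[v, v] =
   '[v, v] * ('[u, u] * '[v, v] - '[u, v] ^+ 2) by ring.
rewrite pmulr_rge0// subr_ge0 => uv.
by rewrite (le_trans (ler_norm _))// -sqrtr_sqr ler_wsqrtr.
Qed.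

Let edistxx x : edist x x = 0.
Proof.
have vxx : vec x x = 0 by have := vec_translate 0 x; rewrite translate0.
by rewrite /edist vxx linear0r sqrtr0.
Qed.

Let edist_positivity x y : edist x y = 0 -> x = y.
Proof.
move/eqP; rewrite sqrtr_eq0 => xy0.
have /inner_eq0 xy : '[vec x y, vec x y] = 0.
  by apply/le_anti; rewrite xy0 inner_ge0.
by rewrite -(translate_vec x y) xy translate0.
Qed.

Let vecD (x y z : E) : vec x z = vec x y + vec y z.
Proof.
rewrite addrC -(vec_translate (vec y z + vec x y) x) translateD.
by rewrite !translate_vec.
Qed.

Let edist_sym x y : edist x y = edist y x.
Proof.
rewrite /edist.
have -> : vec y x = - vec x y.
  apply/eqP; rewrite -addr_eq0 -vecD; apply/eqP.
  by have := vec_translate 0 y; rewrite translate0.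
by rewrite linearNl/= linearNr/= opprK.
Qed.

Let edist_triangle y x z : edist x z <= edist x y + edist y z.
Proof.
rewrite /edist (vecD x y z).
set a := Num.sqrt _; set b := Num.sqrt _; set c := Num.sqrt _.
have bc : 0 <= b + c by rewrite addr_ge0 ?sqrtr_ge0.
rewrite -(ger0_norm bc) -sqrtr_sqr ler_wsqrtr//.
by rewrite inner_sqD sqrrD !sqr_sqrtr// lerD2r lerD2l lerMn2r cauchy_schwarz.
Qed.

HB.instance Definition _ := gen_eqMixin (points E).
HB.instance Definition _ := gen_choiceMixin (points E).
HB.instance Definition _ := @isMetric.Build R (points E) edist
  edistxx edist_positivity edist_sym edist_triangle.

End Metric.

Section Groups.
Context {T : Type}.
Implicit Types (op : T -> T -> T) (A B G N : set T).

Definition mulset op A B : set T := [set op a b | a in A & b in B].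

(* The underlying set of G / N, as the set of left cosets; for normal N the
   group law of G / N is [mulset op]. *)
Definition quotient op G N : set (set T) := [set mulset op [set g] N | g in G].

Definition compose (f g : T -> T) : T -> T := f \o g.

Definition transformation_group (P : set (T -> T)) : Prop :=
  [/\ P id,
      forall f g, P f -> P g -> P (f \o g) &
      forall f, P f -> exists2 g, P g & cancel f g /\ cancel g f].

Definition torsion_free (P : set (T -> T)) : Prop :=
  forall g, P g -> forall k, (0 < k)%N -> iter k g = id -> g = id.

Definition orbit (P : set (T -> T)) (x : T) : set T := [set g x | g in P].

End Groups.

Section Bieberbach.
Context {R : realType} (E : euclideanAffine R).
Local Notation V := (tvect E).
Implicit Types (P : set (E -> E)) (W : {vspace V}) (F : set E).

Definition Iso : set (E -> E) :=
  [set g : E -> E | bijective g /\ forall x y, mdist (g x) (g y) = mdist x y].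

Record bieberbach P : Prop := Bieberbach {
  bieberbach_Iso : P `<=` Iso ;
  bieberbach_group : transformation_group P ;
  bieberbach_torsion_free : torsion_free P ;
  bieberbach_discrete :
    P `<=` isolated (P : set {compact-open, E -> E}) ;
  bieberbach_cocompact :
    exists2 C : set E, compact C & forall x, orbit P x `&` C !=set0 }.

Definition lattice P : set V := [set v | P (@translate _ E v)].

Definition linear_part (g : E -> E) (h : V -> V) : Prop :=
  forall v x, g (translate v x) = translate (h v) (g x).

Definition holonomy P : set (V -> V) :=
  [set h | exists2 g, P g & linear_part g h].

Definition lattice_subspace (L : set V) W : Prop :=
  exists2 s : seq V, (forall v, v \in s -> L v /\ v \in W) & <<s>>%VS = W.

Definition invariant_subspace (H : set (V -> V)) W : Prop :=
  forall h, H h -> forall v, v \in W -> h v \in W.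

Definition is_coset W F : Prop :=
  exists x : E, F = [set translate v x | v in [set v | v \in W]].

(* The kernel of the action of P on the space of all cosets of W. Restriction
   to a generic coset F of W identifies it with a Bieberbach group of F, the
   holonomy group of which is, as a subgroup of [holonomy P], the set
   [holonomy (coset_kernel P W)] of linear parts. *)
Definition coset_kernel P W : set (E -> E) :=
  [set g | P g /\ forall F, is_coset W F -> g @` F = F].

Definition generic_coset P W F : Prop :=
  is_coset W F /\ [set g | P g /\ g @` F = F] = coset_kernel P W.

(* For H := holonomy P this contains [holonomy (coset_kernel P W)], with equality
   if and only if every such h is the linear part of an element of P acting
   trivially on the cosets of W; this fails when W is the direction of the
   reflection (y |-> - y) for the Klein bottle group generated by
   (x, y) |-> (x + 1/2, - y) and (x, y) |-> (x, y + 1). *)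
Definition orth_fixing (H : set (V -> V)) W : set (V -> V) :=
  [set h | H h /\ forall v, v \in orthov (inner E) W -> h v = v].

(* The manifold E / P is the set of P-orbits, and the torus E / L the set of
   orbits of the translations by elements of L. *)
Definition pr P (x : E) : set E := orbit P x.
Definition prT (L : set V) (x : E) : set E :=
  orbit [set @translate _ E v | v in L] x.

(* The projection E / L -> E / P, which sends an L-orbit t to the P-orbit
   that contains t. *)
Definition torus_to_manifold P (t : set E) : set E := \bigcup_(x in t) pr P x.

(* The map L / L0 -> P / N induced by the inclusion v |-> translate v, for
   L0 included in N: it sends a coset C of L0 to the coset of N that contains
   the translations by elements of C. *)
Definition induced (N : set (E -> E)) (C : set V) : set (E -> E) :=
  mulset compose [set @translate _ E v | v in C] N.

End Bieberbach.

(* Main.v *)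
Require Import Defs.
From mathcomp Require Import all_boot all_order all_algebra sesquilinear finmap.
From mathcomp Require Import all_classical all_reals topology.
From mathcomp Require Import ring lra.

Set Implicit Arguments.
Unset Strict Implicit.
Unset Printing Implicit Defensive.

Import Order.TTheory GRing.Theory Num.Theory.

Local Open Scope classical_set_scope.
Local Open Scope card_scope.
Local Open Scope ring_scope.

(** Write [N = P1 P2] and [L12 = L1 L2].

    Intersections as quotients. As [V = V1 (+) V2] and the elements of [P] permute
    the cosets of [V2], for each [g] in [P] the sets [E1] and [g E2] have exactly
    one common point [y_g]. The orbits that meet both [E1] and [E2] are the orbits
    of these points. If [y_g'] lies in the orbit of [y_g], say [y_g' = k y_g], then
    [k] maps a point of [E1] to a point of [E1], so it stabilizes [E1] and, [E1]
    being generic, lies in [P1]; likewise [g'^-1 k g] lies in [P2]. Hence the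
    orbit of [y_g] determines, and is determined by, the double coset [P1 g P2],
    which is [g N] because [P1] and [P2] are normal. So [g N |-> orbit of y_g] is
    a bijection from [P / N] to the intersection of the images of [E1] and [E2].
    The argument only involves a group action, two sets and their stabilizers
    ([meet_orbit_bij]); it applies to [L] as well, and there to any cosets [F1] and
    [F2], since a translation that maps a point of a coset of [V1] into the same
    coset has its vector in [V1]. For a translation [v] in [L] the point of
    [E1] and [v E2] is the same for both groups, which gives the compatibility of
    the two bijections with [L / L12 -> P / N] ([torus_to_manifold_meet]).

    Injectivity. An element of [P1] has a linear part that is the identity modulo
    [V1] and preserves [V2], hence is the identity on [V2]. If a product
    [k1 k2], with [k1] in [P1] and [k2] in [P2], is a translation, the two linear
    parts are inverse to each other, so both are the identity on [V1] and on [V2],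
    and [k1], [k2] are translations. Thus [L] meets [N] in [L12]
    ([coset_kernels_lattice]), and [L / L12 -> P / N] is injective.

    Cardinalities. The map that takes linear parts sends [P] onto [H] with kernel
    [L], and [N] onto [H1 H2], so that [P / N] is an extension of [H / (H1 H2)] by
    [L / L12] ([quotient_extension]).

    Finiteness. [L] contains vectors that span [V], taken from [V1] and [V2], and
    it is discrete, so that only finitely many of its elements have norm below a
    given bound ([finite_bounded]). The group [H] preserves [L] and the norm, and
    its elements are determined by the images of the spanning vectors, so it is
    finite. Every class of [L / L12] has a representative with coordinates between
    0 and 1 with respect to the spanning vectors, so [L / L12] is finite. *)

(** * Isometries of a Euclidean affine space *)

Section Affine.
Context {R : realType} (E : euclideanAffine R).
Local Notation V := (tvect E).
Local Notation "''[' u , v ]" := (inner E u v) : ring_scope.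
Implicit Types (x y z : E) (u v w : V) (g f : E -> E) (W : {vspace V}).

Lemma vec_add x y z : vec x z = vec x y + vec y z.
Proof.
rewrite addrC -(vec_translate (vec y z + vec x y) x) translateD.
by rewrite !translate_vec.
Qed.

Lemma vecxx x : vec x x = 0.
Proof. by have := vec_translate 0 x; rewrite translate0. Qed.

Lemma vec_sym x y : vec y x = - vec x y.
Proof. by apply/eqP; rewrite -addr_eq0 -vec_add vecxx. Qed.

Lemma vec_inj x y z : vec x y = vec x z -> y = z.
Proof. by move=> e; rewrite -(translate_vec x y) e translate_vec. Qed.

Lemma translate_inj x : injective (fun v => translate v x).
Proof. by move=> u v /(congr1 (vec x)); rewrite !vec_translate. Qed.

Lemma innerC u v : '[u, v] = '[v, u].
Proof. by have := hermC (inner E) u v; rewrite expr0 mul1r. Qed.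

Lemma inner_gt0 u : u != 0 -> 0 < '[u, u].
Proof. exact: (neq0_dnorm_gt0 u). Qed.

Lemma inner_ge0 u : 0 <= '[u, u].
Proof.
have [->|u0] := eqVneq u 0; first by rewrite linear0r.
exact/ltW/inner_gt0.
Qed.

Lemma inner_eq0 u : '[u, u] = 0 -> u = 0.
Proof.
by move=> uu0; apply/eqP; apply: contraT => /inner_gt0; rewrite uu0 ltxx.
Qed.

Lemma inner_sqB u v : '[u - v, u - v] = '[u, u] - '[u, v] *+ 2 + '[v, v].
Proof.
rewrite linearBl/= !linearBr/= (innerC v u) mulr2n opprB opprD !addrA.
by rewrite addrAC.
Qed.

Lemma inner_sqlin (a : R) u v w :
  '[w - a *: u - v, w - a *: u - v] =
  '[w, w] + a ^+ 2 * '[u, u] + '[v, v]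
  - a * '[w, u] *+ 2 - '[w, v] *+ 2 + a * '[u, v] *+ 2.
Proof.
rewrite !inner_sqB linearBl/= !linearZl_LR/= !linearZr_LR/=; ring.
Qed.

(** A candidate for the linear part of an arbitrary map; for an isometry the
    choice of the base point does not matter. *)
Definition linpart g (v : V) : V :=
  vec (g (origin E)) (g (translate v (origin E))).

Lemma linear_part_unique g h : linear_part g h -> h = linpart g.
Proof. by move=> gh; apply/funext => v; rewrite /linpart gh vec_translate. Qed.

Lemma linear_part_comp f g hf hg : linear_part f hf -> linear_part g hg ->
  linear_part (f \o g) (hf \o hg).
Proof. by move=> fh gh v x /=; rewrite gh fh. Qed.

Lemma linear_part_translate w : linear_part (@translate _ E w) id.
Proof. by move=> v x; rewrite -!translateD addrC. Qed.

Lemma linear_part_vec g h x y : linear_part g h -> vec (g x) (g y) = h (vec x y).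
Proof. by move=> gh; rewrite -{1}(translate_vec x y) gh vec_translate. Qed.

(** An isometry is affine: in terms of the inner product, the square of the
    norm of [h (a *: u + v) - a *: h u - h v] is a combination of inner products
    of values of [h], which polarisation equates with those of arguments. *)
Lemma isometry_affine g : Iso g ->
  [/\ linear_part g (linpart g), linear (linpart g) &
      forall u v, '[linpart g u, linpart g v] = '[u, v]].
Proof.
move=> [_ gd]; set o := origin E; set h := linpart g.
have hB u v : '[h u - h v, h u - h v] = '[u - v, u - v].
  have := gd (translate v o) (translate u o).
  have -> : mdist (g (translate v o)) (g (translate u o)) =
     Num.sqrt '[h u - h v, h u - h v].
    rewrite [LHS]/(Num.sqrt _); congr (Num.sqrt (inner E _ _));
    by rewrite (vec_add _ (g o)) vec_sym addrC.
  have -> : mdist (translate v o) (translate u o) =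
     Num.sqrt '[u - v, u - v].
    rewrite [LHS]/(Num.sqrt _); congr (Num.sqrt (inner E _ _));
    by rewrite (vec_add _ o) vec_sym !vec_translate addrC.
  by move/eqP; rewrite eqr_sqrt ?inner_ge0// => /eqP.
have h0 : h 0 = 0 by rewrite /h /linpart translate0 vecxx.
have hn u : '[h u, h u] = '[u, u] by have := hB u 0; rewrite h0 !subr0.
have hi u v : '[h u, h v] = '[u, v].
  have := hB u v; rewrite !inner_sqB !hn => /addIr/addrI/oppr_inj.
  by move/eqP; rewrite eqrMn2r //= => /eqP.
have hl : linear h.
  move=> a u v; apply/eqP; rewrite -subr_eq0 opprD addrA; apply/eqP/inner_eq0.
  rewrite inner_sqlin !hi -inner_sqlin.
  have -> : a *: u + v - a *: u - v = 0 by rewrite -addrA -opprD subrr.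
  by rewrite linear0r.
split=> // v x; apply: (@vec_inj (g x)); rewrite vec_translate.
rewrite (vec_add _ (g o)) vec_sym.
have hx y : vec (g o) (g y) = h (vec o y) by rewrite /h /linpart translate_vec.
rewrite !hx (vec_add o x (translate v x)) vec_translate -(scale1r (vec o x)) hl !scale1r.
by rewrite addKr.
Qed.

(** * Cosets of a vector subspace *)

Lemma is_coset_mem W F x y : is_coset W F -> F x -> (F y <-> vec x y \in W).
Proof.
move=> [z ->] [v /= vW <-]; split.
  move=> [w /= wW <-]; rewrite (vec_add _ z) vec_sym !vec_translate.
  by rewrite addrC memvB.
move=> Wxy; exists (v + vec (translate v z) y); first exact: memvD.
by rewrite addrC translateD translate_vec.
Qed.

Lemma is_coset_nonempty W F : is_coset W F -> F !=set0.
Proof.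
by move=> [z ->]; exists z; exists 0; rewrite ?translate0//=; exact: mem0v.
Qed.

Lemma is_cosetP W F x :
  F x -> (forall y, F y <-> vec x y \in W) -> is_coset W F.
Proof.
move=> Fx Fy; exists x; apply/seteqP; split=> [y /Fy xyW | _ [v /= vW <-]].
  by exists (vec x y) => //=; rewrite translate_vec.
by apply/Fy; rewrite vec_translate.
Qed.

Lemma is_coset_eq W F F' x : is_coset W F -> is_coset W F' -> F x -> F' x ->
  F = F'.
Proof.
move=> cF cF' Fx F'x; apply/seteqP; split=> y.
  by move=> /(is_coset_mem _ cF Fx)/(is_coset_mem _ cF' F'x).
by move=> /(is_coset_mem _ cF' F'x)/(is_coset_mem _ cF Fx).
Qed.

Lemma is_coset_through W x : is_coset W [set y | vec x y \in W].
Proof. by apply: (@is_cosetP _ _ x) => //=; rewrite vecxx mem0v. Qed.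

Lemma cosets_meet (V1 V2 : {vspace V}) F1 F2 :
  (V1 + V2)%VS = fullv -> (V1 :&: V2)%VS = 0%VS ->
  is_coset V1 F1 -> is_coset V2 F2 -> exists y, F1 `&` F2 = [set y].
Proof.
move=> VD VI c1 c2.
have [x1 F1x1] := is_coset_nonempty c1; have [x2 F2x2] := is_coset_nonempty c2.
have : vec x1 x2 \in (V1 + V2)%VS by rewrite VD memvf.
case/memv_addP => v1 v1V1 [v2 v2V2 e12].
pose y := translate v1 x1.
have F1y : F1 y by apply/(is_coset_mem _ c1 F1x1); rewrite vec_translate.
have F2y : F2 y.
  apply/(is_coset_mem _ c2 F2x2).
  rewrite (vec_add _ x1) vec_sym vec_translate e12 opprD addrAC addNr add0r.
  by rewrite memvN.
exists y; apply/seteqP; split=> [z [F1z F2z]|_ ->//].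
apply: (@vec_inj y); rewrite vecxx; apply/eqP; rewrite -memv0 -VI memv_cap.
by apply/andP; split; [apply/(is_coset_mem _ c1 F1y) | apply/(is_coset_mem _ c2 F2y)].
Qed.

End Affine.

(** * Finiteness of bounded sets of lattice vectors *)

Lemma finite_inj {T T' : Type} (A : set T) (f : T -> T') :
  {in A &, injective f} -> finite_set (f @` A) -> finite_set A.
Proof. by move=> /inj_card_eq/eq_finite_set ->. Qed.

Lemma finite_words {T : eqType} (A : set T) n : finite_set A ->
  finite_set [set s : seq T | size s = n /\ forall x, x \in s -> A x].
Proof.
move=> fA; elim: n => [|n IH].
  by apply: sub_finite_set (finite_set1 [::]) => s /= [/size0nil].
apply: sub_finite_set (finite_image2 (@cons T) fA IH) => -[|a s] [//= [ss] sA].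
exists a; first by apply: sA; rewrite mem_head.
by exists s => //; split=> // x xs; apply: sA; rewrite in_cons xs orbT.
Qed.

Section Discrete.
Context {R : realType} (E : euclideanAffine R).
Local Notation V := (tvect E).
Local Notation "''[' u , v ]" := (inner E u v) : ring_scope.
Implicit Types (x y z : E) (u v w : V) (L : set V).

Local Notation b := (vbasis {:V}).

Lemma coord_fullv v : v = \sum_i coord b i v *: b`_i.
Proof. exact: coord_vbasis (memvf v). Qed.

Definition gram := \matrix_(i < \dim {:V}, j < \dim {:V}) '[b`_i, b`_j].

Lemma inner_sum n (a : 'I_n -> R) (c : 'I_n -> V) v :
  '[\sum_i a i *: c i, v] = \sum_i a i * '[c i, v].
Proof.
by rewrite linear_sumlz/=; apply: eq_bigr => i _; rewrite linearZl_LR.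
Qed.

Lemma inner_coord_le n (a : 'I_n -> R) (c : 'I_n -> V) (d : R) :
  0 <= d -> (forall i, `|a i| <= d) ->
  '[\sum_i a i *: c i, \sum_i a i *: c i] <=
     d ^+ 2 * \sum_i \sum_j `|'[c i, c j]|.
Proof.
move=> d0 ad; rewrite inner_sum mulr_sumr; apply: ler_sum => i _.
rewrite innerC inner_sum !mulr_sumr; apply: ler_sum => j _.
rewrite (le_trans (ler_norm _))// !normrM mulrA (innerC (c j)).
by rewrite ler_wpM2r// expr2 ler_pM.
Qed.

(** A weak form of the Cauchy-Schwarz inequality, from the norms of [u - v] and
    [u + v]. *)
Lemma inner_le u v : `|'[u, v]| <= '[u, u] + '[v, v].
Proof.
have h1 := inner_ge0 (u - v); have h2 := inner_ge0 (u - - v).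
have h3 := inner_ge0 u; have h4 := inner_ge0 v.
move: h1 h2; rewrite !inner_sqB !linearNr /= linearNl /= opprK => h1 h2.
by rewrite ler_norml; apply/andP; split; lra.
Qed.

Lemma gram_unit : gram \in unitmx.
Proof.
rewrite -row_free_unit -kermx_eq0; apply/rowV0P => u /sub_kermxP uG.
pose v := \sum_i u 0 i *: b`_i.
have vb (j : 'I_(\dim {:V})) : '[v, b`_j] = 0.
  rewrite /v inner_sum; have := congr1 (fun M : 'rV_(\dim {:V}) => M 0 j) uG.
  rewrite !mxE => uGj; rewrite -[RHS]uGj; apply: eq_bigr => i _.
  by rewrite !mxE.
have v0 : v = 0.
  apply: inner_eq0; rewrite {2}(coord_fullv v) innerC inner_sum big1// => i _.
  by rewrite innerC vb mulr0.
apply/rowP => i; rewrite mxE.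
by have /freeP := basis_free (vbasisP {:V}); apply; exact: v0.
Qed.

(** Solving the Gram system [<v, b_j> = sum_i c_i <b_i, b_j>] for the coordinates
    [c_i] bounds them in terms of the norm of [v]. *)
Lemma coord_bounded (r : R) :
  exists2 d : R, 0 <= d & forall v, '[v, v] <= r -> forall i, `|coord b i v| <= d.
Proof.
pose n := \dim {:V}.
pose D : R := \sum_(j < n) \sum_(i < n) (r + '[b`_j, b`_j]) * `|invmx gram j i|.
exists `|D| => // v vr i.
have r0 := le_trans (inner_ge0 v) vr.
pose c := \row_i coord b i v; pose p := \row_(j < n) '[v, b`_j].
have pE : p = c *m gram.
  apply/rowP => j; rewrite !mxE {1}(coord_fullv v) inner_sum.
  by apply: eq_bigr => k _; rewrite !mxE.
have -> : coord b i v = (p *m invmx gram) 0 i.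
  by rewrite pE mulmxK ?gram_unit// mxE.
rewrite mxE (le_trans (ler_norm_sum _ _ _))// (le_trans _ (ler_norm _))//.
apply: ler_sum => j _; rewrite normrM mxE.
have le1 : `|'[v, b`_j]| <= r + '[b`_j, b`_j].
  by rewrite (le_trans (inner_le _ _))// lerD2r.
apply: (@le_trans _ _ ((r + '[b`_j, b`_j]) * `|invmx gram j i|)).
  by rewrite ler_wpM2r.
rewrite [leRHS](bigD1 i)//= lerDl sumr_ge0// => k _.
by rewrite mulr_ge0 // addr_ge0 // inner_ge0.
Qed.

(** Pigeonhole: on vectors of squared norm at most [r], the coordinates multiplied by a
    large [N] have boundedly many integer parts, and vectors of [L] with the same
    integer parts are so close to each other that they coincide. *)
Lemma finite_bounded L (e : R) : 0 < e ->
  (forall u v, L u -> L v -> L (u - v)) ->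
  (forall v, L v -> '[v, v] < e -> v = 0) ->
  forall r : R, finite_set (L `&` [set v | '[v, v] <= r]).
Proof.
move=> e0 LB Le r; have [d d0 dP] := coord_bounded r.
pose S : R := \sum_(i < \dim {:V}) \sum_(j < \dim {:V}) `|'[b`_i, b`_j]|.
have S0 : 0 <= S by apply: sumr_ge0 => i _; apply: sumr_ge0.
(* [N] is such that coordinates that differ by at most [1 / N] give a vector of
   squared norm less than [e]. *)
pose N := (Num.truncn ((S + 1) / e)).+1.
have N0 : 0 < N%:R :> R by rewrite ltr0n.
have NS : N%:R^-1 ^+ 2 * S < e.
  have h : (S + 1) / e < N%:R by rewrite truncnS_gt.
  have N1 : 1 <= N%:R :> R by rewrite ler1n.
  rewrite expr2 -mulrA mulrC ltr_pdivrMr// (@le_lt_trans _ _ S)//.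
    by rewrite ler_piMl// invf_le1.
  move: h; rewrite ltr_pdivrMr// => h; rewrite mulrC in h.
  by rewrite (lt_trans _ h)// ltrDl.
pose M := (Num.truncn (N%:R * (d + d))).+1.
pose I := index_enum 'I_(\dim {:V}).
(* Adding [d] makes the coordinates nonnegative, so that truncation is the floor. *)
pose code v := [seq Num.truncn (N%:R * (coord b i v + d)) | i <- I].
apply: (@finite_inj _ _ _ code).
  move=> u v /set_mem[Lu /= ur] /set_mem[Lv /= vr] uv.
  apply/eqP; rewrite -subr_eq0; apply/eqP/Le; first exact: LB.
  rewrite (coord_fullv (u - v)); apply: le_lt_trans NS.
  apply: inner_coord_le => [|i]; first by rewrite invr_ge0 ltW.
  have tuv := (iffRL (eq_in_map _ _ _)) uv i (mem_index_enum i).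
  have pos w : '[w, w] <= r -> 0 <= N%:R * (coord b i w + d).
    move=> wr; rewrite mulr_ge0 ?(ltW N0)// -lerBlDr sub0r.
    by have := dP _ wr i; rewrite ler_norml => /andP[].
  have := truncn_itv (pos _ ur); have := truncn_itv (pos _ vr).
  rewrite tuv => /andP[a1 a2] /andP[b1 b2].
  rewrite linearB/= -(ler_pM2l N0) divff ?gt_eqF// -[N%:R in X in X <= _]gtr0_norm//.
  rewrite -normrM ler_norml; rewrite -natr1 in a2 b2; apply/andP; split; lra.
apply: sub_finite_set (finite_words (size I) (finite_II M)) => _ [v [Lv /= vr] <-].
split; first by rewrite size_map.
move=> _ /mapP[i _ ->] /=; rewrite ltnS le_truncn// ler_pM2l// lerD2r.
by have := dP _ vr i; rewrite ler_norml => /andP[].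
Qed.

(** The image of the neighborhood filter of 0 in [V] under [v |-> translate v]. *)
Definition small_translations : set_system (E -> E) :=
  [set A | exists2 e : R, 0 < e & forall v, '[v, v] < e -> A (@translate _ E v)].

Lemma small_translations_filter : Filter small_translations.
Proof.
split.
- by exists 1.
- move=> A B [a a0 aA] [c c0 cB]; exists (Num.min a c).
    by rewrite lt_min a0.
  by move=> v; rewrite lt_min => /andP[va vc]; split; [exact: aA|exact: cB].
- by move=> A B AB [a a0 aA]; exists a => // v /aA /AB.
Qed.

(** A compact set contained in an open set remains in it under all sufficiently
    small translations. *)
Lemma small_translations_cvg :
  {compact-open, small_translations --> (id : E -> E)}.
Proof.
have FF := small_translations_filter.
apply/compact_open_cvgP => K O cK oO KO.
have := (iffLR (compact_near_coveringP K) cK) _ small_translations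
  (fun g x => O (g x)) FF.
case.
  move=> x Kx.
  have : nbhs x O by apply: open_nbhs_nbhs; split=> //; apply: KO; exists x.
  rewrite -nbhs_ballE => -[r /= r0 rO].
  exists (ball x (r / 2), [set g | forall y, ball y (r / 2) (g y)]); last first.
    move=> [y g] /= [xy gy]; apply: rO.
    by rewrite (splitr r); apply: ball_triangle xy (gy y).
  split=> /=; first by apply: nbhsx_ballx; rewrite divr_gt0.
  exists ((r / 2) ^+ 2); first by rewrite exprn_gt0// divr_gt0.
  move=> v vr y; rewrite ballEmdist /= [X in X < _]/(Num.sqrt _) vec_translate.
  rewrite -[r / 2](@ger0_norm _) ?divr_ge0 ?ltW// -sqrtr_sqr ltr_sqrt//.
  by rewrite exprn_gt0// divr_gt0.
by move=> e e0 eP; exists e => // v /eP KP _ [x Kx <-]; exact: KP.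
Qed.

(** The identity is isolated in [P], and small translations are close to it. *)
Lemma lattice_discrete (P : set (E -> E)) : bieberbach P ->
  exists2 e : R, 0 < e & forall v, lattice P v -> '[v, v] < e -> v = 0.
Proof.
move=> bP; have [Pid _ _] := bieberbach_group bP.
have [_ [U nU UP]] := bieberbach_discrete bP Pid.
have [e e0 eU] := small_translations_cvg nU.
exists e => // v Lv /eU Uv; have : (U `&` P) (@translate _ E v) by split.
rewrite UP /= => /(congr1 (fun g => vec (origin E) (g (origin E)))).
by rewrite vec_translate vecxx.
Qed.

End Discrete.

(** * Cosets and quotients *)

(** The groups at hand have different laws: addition on the lattice, composition
    on the group of isometries and on the holonomy group. They are handled as
    subsets of a type closed under an associative operation. *)
Record group_law {T} (op : T -> T -> T) (e : T) (G : set T) : Prop := GroupLaw {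
  grpA : associative op ;
  grp1x : left_id e op ;
  grpx1 : right_id e op ;
  grp1 : G e ;
  grpM : forall a b, G a -> G b -> G (op a b) ;
  grpV : forall a, G a -> exists2 b, G b & op a b = e /\ op b a = e }.

(** Normality in the form [N g] included in [g N], for every [g] in [G]. *)
Record normal_in {T} (op : T -> T -> T) (e : T) (G N : set T) : Prop := NormalIn {
  nrm_grp : group_law op e N ;
  nrm_sub : N `<=` G ;
  nrmJ : forall g n, G g -> N n -> exists2 n', N n' & op n g = op g n' }.

Section Cosets.
Context {T : Type} {op : T -> T -> T} {e : T} {G : set T}.
Hypothesis gG : group_law op e G.
Implicit Types N : set T.

Local Notation coset g N := (mulset op [set g] N).

Lemma grp_cancel a b c : G a -> op a b = op a c -> b = c.
Proof.
move=> /(grpV gG)[a' _ [_ a'a]] /(congr1 (op a')).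
by rewrite !(grpA gG) a'a !(grp1x gG).
Qed.

Lemma cosetE g N : coset g N = [set op g n | n in N].
Proof.
apply/seteqP; split=> [_ [_ -> [n Nn <-]]|_ [n Nn <-]]; first by exists n.
by exists g => //; exists n.
Qed.

Lemma coset_eqP N g g' : group_law op e N ->
  (exists2 n, N n & g' = op g n) <-> coset g N = coset g' N.
Proof.
move=> gN; split=> [[n Nn ->]|]; last first.
  rewrite !cosetE => eq; have : [set op g n | n in N] g'.
    by rewrite eq; exists e; [exact: grp1 gN | exact: grpx1 gN g'].
  by case=> n Nn <-; exists n.
rewrite !cosetE; have [n' Nn' [nn' n'n]] := grpV gN Nn.
apply/seteqP; split=> [_ [m Nm <-]|_ [m Nm <-]].
  exists (op n' m); first exact: grpM gN _ _ Nn' Nm.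
  by rewrite -(grpA gG) (grpA gG n) nn' (grp1x gG).
by exists (op n m); [exact: grpM gN _ _ Nn Nm | rewrite (grpA gG)].
Qed.

Lemma nrmJV N g n : normal_in op e G N -> G g -> N n ->
  exists2 n', N n' & op g n = op n' g.
Proof.
move=> nN Gg Nn; have [g' Gg' [gg' g'g]] := grpV gG Gg.
have [n' Nn' eq] := nrmJ nN Gg' Nn; exists n' => //.
by rewrite -[LHS](grpx1 gG) -g'g (grpA gG) -(grpA gG g) eq (grpA gG g) gg' (grp1x gG).
Qed.

Lemma mulset_normal N1 N2 : normal_in op e G N1 -> normal_in op e G N2 ->
  normal_in op e G (mulset op N1 N2).
Proof.
move=> n1 n2; have g1 := nrm_grp n1; have g2 := nrm_grp n2; split.
- split; [exact: grpA gG|exact: grp1x gG|exact: grpx1 gG| | |].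
  + exists e; first exact: grp1 g1.
    by exists e; [exact: grp1 g2 | exact: grp1x gG e].
  + move=> _ _ [a Na [b Nb <-]] [c Nc [d Nd <-]].
    have [b' Nb' eq] := nrmJ n2 (nrm_sub n1 Nc) Nb.
    exists (op a c); first exact: grpM g1 _ _ Na Nc.
    exists (op b' d); first exact: grpM g2 _ _ Nb' Nd.
    by rewrite -!(grpA gG); congr (op a _); rewrite !(grpA gG) eq.
  + move=> _ [a Na [b Nb <-]].
    have [a' Na' [aa' a'a]] := grpV g1 Na; have [b' Nb' [bb' b'b]] := grpV g2 Nb.
    have [c Nc eq] := nrmJ n2 (nrm_sub n1 Na') Nb'.
    exists (op b' a').
      by rewrite eq; exists a' => //; exists c.
    split.
      by rewrite -(grpA gG) (grpA gG b) bb' (grp1x gG).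
    by rewrite -(grpA gG) (grpA gG a') a'a (grp1x gG).
- move=> _ [a Na [b Nb <-]].
  exact: grpM gG _ _ (nrm_sub n1 Na) (nrm_sub n2 Nb).
- move=> g _ Gg [a Na [b Nb <-]].
  have [b' Nb' eb] := nrmJ n2 Gg Nb; have [a' Na' ea] := nrmJ n1 Gg Na.
  exists (op a' b'); first by exists a' => //; exists b'.
  by rewrite -(grpA gG) eb !(grpA gG) ea.
Qed.

Lemma coset_mul N g g' : normal_in op e G N -> G g -> G g' ->
  mulset op (coset g N) (coset g' N) = coset (op g g') N.
Proof.
move=> nN Gg Gg'; have gN := nrm_grp nN.
rewrite !cosetE; apply/seteqP; split.
  move=> _ [_ [n Nn <-] [_ [m Nm <-] <-]].
  have [n' Nn' eq] := nrmJ nN Gg' Nn.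
  exists (op n' m); first exact: grpM gN _ _ Nn' Nm.
  by rewrite -!(grpA gG); congr (op g _); rewrite !(grpA gG) eq.
move=> _ [n Nn <-]; exists g.
  by exists e; [exact: grp1 gN | exact: grpx1 gG g].
by exists (op g' n); [exists n | rewrite (grpA gG)].
Qed.

End Cosets.

(** * Orbits that meet two sets *)

(** For a coset [C] of [N] this is the orbit of a single point, the common point of
    [A] and [g B] for any [g] in [C]: see [meet_orbitE]. The union avoids the choice
    of a representative of [C]. *)
Definition meet_orbit {T X : Type} (G : set T) (act : T -> X -> X) (A B : set X)
    (C : set T) : set X :=
  \bigcup_(y in A `&` [set act g b | g in C & b in B]) [set act g y | g in G].

Section Meet.
Context {T X : Type} {op : T -> T -> T} {e : T} {G : set T} {act : T -> X -> X}.
Context {A B : set X} {NA NB : set T}.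
Hypothesis gG : group_law op e G.
Hypothesis act1 : forall x, act e x = x.
Hypothesis actM : forall a b x, act (op a b) x = act a (act b x).
Hypothesis nNA : normal_in op e G NA.
Hypothesis nNB : normal_in op e G NB.
Hypothesis stabA : forall g x, G g -> A x -> (A (act g x) <-> NA g).
Hypothesis stabB : forall g x, G g -> B x -> (B (act g x) <-> NB g).
Hypothesis meet1 : forall g, G g -> exists y, A `&` act g @` B = [set y].

Local Notation orb x := [set act g x | g in G].
Local Notation N := (mulset op NA NB).

Lemma orbit_act g x : G g -> orb (act g x) = orb x.
Proof.
move=> Gg; have [g' Gg' [gg' g'g]] := grpV gG Gg.
apply/seteqP; split=> [_ [k Gk <-]|_ [k Gk <-]].
  by exists (op k g); [exact: grpM gG _ _ Gk Gg | rewrite actM].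
exists (op k g'); first exact: grpM gG _ _ Gk Gg'.
by rewrite !actM -(actM g' g) g'g act1.
Qed.

(** If [g] is replaced with [g a c], where [a] is in [NA] and [c] in [NB], then
    [g a c B = g a B = a' g B] for some [a'] in [NA], so the common point with [A]
    is moved by [a'] and stays in the same orbit. *)
Lemma meet_orbitE g b : G g -> B b -> A (act g b) ->
  meet_orbit G act A B (mulset op [set g] N) = orb (act g b).
Proof.
move=> Gg Bb Ay; set y := act g b.
have gN := nrm_grp (mulset_normal gG nNA nNB).
apply/seteqP; split; last first.
  move=> z oz; exists y => //; split=> //; exists g; last by exists b.
  rewrite cosetE; exists e; [exact: grp1 gN | exact: grpx1 gG g].
move=> z [y' [Ay' [k]]]; rewrite (cosetE (op := op)) => -[_ [a Na [c Nc <-]] <-].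
move=> [b' Bb' eq] oz.
have Bcb' : B (act c b') by apply/stabB => //; exact: nrm_sub nNB _ Nc.
have [a' Na' ea] := nrmJV gG nNA Gg Na.
have Ga' := nrm_sub nNA Na'.
have [a'' Na'' [aa' a'a]] := grpV (nrm_grp nNA) Na'.
have y'E : y' = act a' (act g (act c b')).
  by rewrite -eq -!actM (grpA gG g) ea.
have Ay2 : A (act a'' y') by apply/stabA => //; exact: nrm_sub nNA _ Na''.
have y2E : act a'' y' = act g (act c b') by rewrite y'E -!actM a'a (grp1x gG).
have [y0 my0] := meet1 Gg.
have : [set y0] y by rewrite -my0; split=> //; exists b.
have : [set y0] (act a'' y').
  by rewrite -my0; split=> //; rewrite y2E; exists (act c b').
move=> ey' ey; rewrite (ey : y = y0) -(ey' : _ = y0) orbit_act //; exact: nrm_sub nNA _ Na''.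
Qed.

(** Injectivity: if [k] maps the common point of [A] and [g B] to that of [A] and
    [g' B], then [k] is in [NA] and [m = g'^-1 k g] is in [NB]; writing
    [k g = g k'] with [k'] in [NA] gives [g' = g k' m^-1]. *)
Lemma meet_orbit_bij :
  set_bij (quotient op G N) ((fun x => orb x) @` A `&` (fun x => orb x) @` B)
    (meet_orbit G act A B).
Proof.
have meetP g : G g -> exists2 b, B b & A (act g b).
  move=> /meet1[y my]; have [Ay [b Bb yE]] : (A `&` act g @` B) y by rewrite my.
  by exists b => //; rewrite yE.
have nN := mulset_normal gG nNA nNB.
split.
- move=> _ [g Gg <-]; have [b Bb Ay] := meetP _ Gg.
  rewrite (meet_orbitE Gg Bb Ay); split; first by exists (act g b).
  by exists b => //; rewrite orbit_act.
- move=> _ _ /set_mem[g Gg <-] /set_mem[g' Gg' <-].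
  have [b Bb Ay] := meetP _ Gg; have [b' Bb' Ay'] := meetP _ Gg'.
  rewrite (meet_orbitE Gg Bb Ay) (meet_orbitE Gg' Bb' Ay') => eq.
  have [k Gk ky] : orb (act g b) (act g' b').
    by rewrite eq; exists e; [exact: grp1 gG | rewrite act1].
  have NAk : NA k by apply/(stabA Gk Ay); rewrite ky.
  have [k' NAk' kE] := nrmJ nNA Gg NAk.
  have [h Gh [g'h hg']] := grpV gG Gg'.
  have Gm : G (op h (op k g)) by do 2?[apply: (grpM gG) => //].
  have NBm : NB (op h (op k g)).
    by apply/(stabB Gm Bb); rewrite !actM ky -actM hg' act1.
  have [m' NBm' [mm' m'm]] := grpV (nrm_grp nNB) NBm.
  apply/(coset_eqP gG _ _ (nrm_grp nN)); exists (op k' m').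
    by exists k' => //; exists m'.
  rewrite (grpA gG) -kE -[op k g](grp1x gG) -g'h -(grpA gG g') -(grpA gG g').
  by rewrite mm' (grpx1 gG).
- move=> t [[y Ay <-] [b Bb eq]].
  have [g Gg gE] : orb b y.
    by rewrite eq; exists e; [exact: grp1 gG | rewrite act1].
  exists (mulset op [set g] N); first by exists g.
  by rewrite (meet_orbitE Gg Bb) gE.
Qed.

End Meet.

(** * Quotients of a group extension *)

(** The map between quotients induced by [j]; for [j := translate] it is
    [induced N]. *)
Definition induced_coset {U T : Type} (op : T -> T -> T) (j : U -> T) (N : set T)
    (C : set U) : set T := mulset op (j @` C) N.

Section Extension.
Context {U T T' : Type} {opU : U -> U -> U} {op : T -> T -> T} {op' : T' -> T' -> T'}.
Context {eU : U} {e : T} {e' : T'} {M : set U} {G : set T} {K : set T'}.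
Context {j : U -> T} {p : T -> T'} {M0 : set U} {N : set T}.
Hypothesis gM : group_law opU eU M.
Hypothesis gG : group_law op e G.
Hypothesis gK : group_law op' e' K.
Hypothesis nM0 : normal_in opU eU M M0.
Hypothesis nN : normal_in op e G N.
Hypothesis jM : forall a b, j (opU a b) = op (j a) (j b).
Hypothesis jG : forall m, M m -> G (j m).
Hypothesis jN : forall m, M m -> (N (j m) <-> M0 m).
Hypothesis pM : forall a b, G a -> G b -> p (op a b) = op' (p a) (p b).
Hypothesis pK : p @` G = K.
Hypothesis ker_p : forall g, G g -> (p g = e' <-> exists2 m, M m & g = j m).

Local Notation induced_coset := (induced_coset op j N).

Lemma induced_cosetE m : M m ->
  induced_coset (mulset opU [set m] M0) = mulset op [set j m] N.
Proof.
move=> Mm; have gN := nrm_grp nN; rewrite /induced_coset !cosetE.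
apply/seteqP; split.
  move=> _ [_ [_ [n M0n <-] <-] [k Nk <-]].
  exists (op (j n) k); last by rewrite jM (grpA gG).
  by apply: (grpM gN) => //; apply/jN => //; exact: nrm_sub nM0 _ M0n.
move=> _ [n Nn <-]; exists (j m); last by exists n.
exists m => //; exists eU; [exact: grp1 (nrm_grp nM0) | exact: grpx1 gM m].
Qed.

Lemma induced_coset_sub :
  induced_coset @` quotient opU M M0 `<=` quotient op G N.
Proof.
move=> _ [_ [m Mm <-] <-]; rewrite (induced_cosetE Mm).
by exists (j m) => //; exact: jG.
Qed.

Lemma induced_coset_morph :
  {in quotient opU M M0 &,
    {morph induced_coset : A B / mulset opU A B >-> mulset op A B}}.
Proof.
move=> _ _ /set_mem[m Mm <-] /set_mem[n Mn <-].
rewrite (coset_mul gM nM0 Mm Mn) !induced_cosetE //; last exact: grpM gM _ _ Mm Mn.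
by rewrite jM (coset_mul gG nN) //; exact: jG.
Qed.

Lemma jcoset_inj m n : M m -> M n ->
  mulset op [set j m] N = mulset op [set j n] N ->
  mulset opU [set m] M0 = mulset opU [set n] M0.
Proof.
move=> Mm Mn /(coset_eqP gG _ _ (nrm_grp nN))[k Nk nE].
have [m' Mm' [mm' m'm]] := grpV gM Mm.
apply/(coset_eqP gM _ _ (nrm_grp nM0)); exists (opU m' n); last first.
  by rewrite (grpA gM) mm' (grp1x gM).
apply/jN; first exact: grpM gM _ _ Mm' Mn.
suff -> : j (opU m' n) = k by [].
apply: (grp_cancel gG (jG Mm)).
by rewrite -jM (grpA gM) mm' (grp1x gM).
Qed.

Lemma induced_coset_inj : set_inj (quotient opU M M0) induced_coset.
Proof.
move=> _ _ /set_mem[m Mm <-] /set_mem[n Mn <-].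
by rewrite !induced_cosetE //; exact: jcoset_inj.
Qed.

Lemma morph1 : p e = e'.
Proof.
have Kpe : K (p e) by rewrite -pK; exists e; [exact: grp1 gG|].
apply: (grp_cancel gK Kpe).
by rewrite -pM ?(grp1x gG) ?(grpx1 gK)//; exact: grp1 gG.
Qed.

Lemma normal_image : normal_in op' e' K (p @` N).
Proof.
have gN := nrm_grp nN; have NG := nrm_sub nN; split.
- split; [exact: grpA gK|exact: grp1x gK|exact: grpx1 gK| | |].
  + by exists e; [exact: grp1 gN | exact: morph1].
  + move=> _ _ [a Na <-] [b Nb <-]; exists (op a b); first exact: grpM gN _ _ Na Nb.
    by rewrite pM //; exact: NG.
  + move=> _ [a Na <-]; have [b Nb [ab ba]] := grpV gN Na.
    by exists (p b); [exists b | rewrite -!pM ?ab ?ba ?morph1 //; exact: NG].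
- by move=> _ [a Na <-]; rewrite -pK; exists a => //; exact: NG.
- move=> k _ + [n Nn <-]; rewrite -pK => -[g Gg <-].
  have [n' Nn' eq] := nrmJ nN Gg Nn; exists (p n'); first by exists n'.
  by rewrite -(pM (NG _ Nn) Gg) eq pM //; exact: NG.
Qed.

(** Choose [s D] in [G] over each class [D] of [K / p N]. The classes of [G / N]
    over [D] are the [s D . j m . N] with [m] in [M], and [m] matters only modulo
    [M0], the inverse image of [N] under [j]. *)
Lemma quotient_extension :
  exists phi, set_bij (quotient opU M M0 `*` quotient op' K (p @` N))
                      (quotient op G N) phi.
Proof.
have /choice[s sP] : forall D, exists g, G g /\
    (quotient op' K (p @` N) D -> D = mulset op' [set p g] (p @` N)).
  move=> D; have [[x + DE]|nD] := pselect (quotient op' K (p @` N) D).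
    by rewrite -pK => -[g Gg gx]; exists g; split=> // _; rewrite -DE gx.
  by exists e; split=> //; exact: grp1 gG.
have Gs D : G (s D) by have [] := sP D.
have sE D : quotient op' K (p @` N) D -> D = mulset op' [set p (s D)] (p @` N).
  by have [_] := sP D.
have gN := nrm_grp nN; have nN' := normal_image.
pose phi (CD : set U * set T') := mulset op [set s CD.2] (induced_coset CD.1).
have phiE m D : M m ->
    phi (mulset opU [set m] M0, D) = mulset op [set op (s D) (j m)] N.
  move=> Mm; rewrite /phi/= (induced_cosetE Mm) !cosetE.
  apply/seteqP; split=> [_ [_ [n Nn <-] <-]|_ [n Nn <-]].
    by exists n => //; rewrite (grpA gG).
  by exists (op (j m) n); [exists n | rewrite (grpA gG)].
have pj m : M m -> p (j m) = e' by move=> Mm; apply/ker_p; [exact: jG|exists m].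
exists phi; split.
- move=> [_ D] [/= [m Mm <-] qD]; rewrite phiE //; exists (op (s D) (j m)) => //.
  by apply: grpM gG _ _ _ _ => //; exact: jG.
- move=> [_ D] [_ D'] /set_mem[/= [m Mm <-] qD] /set_mem[/= [n Mn <-] qD'].
  rewrite !phiE // => eq.
  have DD' : D = D'.
    rewrite (sE _ qD) (sE _ qD').
    have /(coset_eqP gG _ _ gN)[k Nk nE] := eq.
    apply/(coset_eqP gK _ _ (nrm_grp nN')); exists (p k); first by exists k.
    have := congr1 p nE; have Gk := nrm_sub nN Nk.
    rewrite !pM ?pj ?(grpx1 gK) //; try exact: jG.
    by apply: grpM gG _ _ _ _ => //; exact: jG.
  rewrite DD' in eq *; congr pair.
  apply: (jcoset_inj Mm Mn).
  have /(coset_eqP gG _ _ gN)[k Nk nE] := eq.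
  apply/(coset_eqP gG _ _ gN); exists k => //.
  by apply: (grp_cancel gG (Gs D')); rewrite nE (grpA gG).
- move=> _ [g Gg <-]; pose D := mulset op' [set p g] (p @` N).
  have qD : quotient op' K (p @` N) D.
    by exists (p g) => //; rewrite -pK; exists g.
  have /esym/(coset_eqP gK _ _ (nrm_grp nN'))[_ [n Nn <-]] := sE _ qD.
  have Gn := nrm_sub nN Nn.
  have [t Gt [st ts]] := grpV gG (Gs D).
  move=> psD.
  have [k Nk [nk kn]] := grpV gN Nn; have Gk := nrm_sub nN Nk.
  have [m Mm mE] : exists2 m, M m & op t (op g k) = j m.
    apply/ker_p; first by do 2?[apply: (grpM gG) => //].
    rewrite pM //; last exact: grpM gG _ _ Gg Gk.
    rewrite pM // psD -(grpA gK) -(pM Gn Gk) nk morph1 (grpx1 gK) -pM //.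
    by rewrite ts morph1.
  exists (mulset opU [set m] M0, D); first by split=> //=; exists m.
  rewrite phiE // -mE; apply/(coset_eqP gG _ _ gN); exists n => //.
  by rewrite !(grpA gG) st (grp1x gG) -(grpA gG) kn (grpx1 gG).
Qed.

End Extension.

Lemma group_law_opp {V : zmodType} (M : set V) v :
  group_law +%R 0 M -> M v -> M (- v).
Proof.
move=> gM /(grpV gM)[w Mw [vw _]].
by have <- : w = - v by apply/eqP; rewrite -addr_eq0 addrC vw.
Qed.

Lemma group_law_mulrz {V : zmodType} (M : set V) v (z : int) :
  group_law +%R 0 M -> M v -> M (v *~ z).
Proof.
move=> gM Mv.
have Mn n : M (v *+ n).
  elim: n => [|n IH]; first by rewrite mulr0n; exact: grp1 gM.
  by rewrite mulrS; exact: grpM gM _ _ Mv IH.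
case: z => n; first by rewrite -pmulrn.
by rewrite NegzE mulrNz -pmulrn; exact: group_law_opp.
Qed.

(** * The lattice and the holonomy group of a Bieberbach group *)

Lemma linear_sum_eq {R : nzRingType} {V : lmodType R} (f : V -> V) n
    (a : 'I_n -> R) (c : 'I_n -> V) : linear f ->
  f (\sum_i a i *: c i) = \sum_i a i *: f (c i).
Proof.
move=> fl.
have f0 : f 0 = 0 by have := fl (-1) 0 0; rewrite scaler0 addr0 scaleN1r addNr.
have fD : {morph f : u v / u + v} by move=> u v; have := fl 1 u v; rewrite !scale1r.
rewrite (big_morph f fD f0); apply: eq_bigr => i _.
by have := fl (a i) (c i) 0; rewrite f0 !addr0.
Qed.

Lemma linear_span_eq {R : fieldType} {V : vectType R} (f g : V -> V) (s : seq V) :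
  linear f -> linear g -> {in s, f =1 g} -> {in <<s>>%VS, f =1 g}.
Proof.
move=> fl gl fg v vs; rewrite (coord_span (X := in_tuple s) vs).
rewrite !linear_sum_eq//; apply: eq_bigr => i _; congr (_ *: _).
by apply: fg; exact: mem_nth.
Qed.

Section Bieberbach.
Context {R : realType} (E : euclideanAffine R) (P : set (E -> E)).
Hypothesis bP : bieberbach P.
Local Notation V := (tvect E).
Local Notation "''[' u , v ]" := (inner E u v) : ring_scope.
Local Notation L := (lattice P).
Local Notation H := (holonomy P).
Implicit Types (x y z : E) (u v w : V) (W : {vspace V}).

Lemma bieberbach_group_law : group_law (@compose E) id P.
Proof.
have [Pid PM PV] := bieberbach_group bP; split=> //.
move=> f /PV[g Pg [fg gf]]; exists g => //.
by split; apply/funext => x; [exact: gf|exact: fg].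
Qed.
Let gP := bieberbach_group_law.

Lemma bieberbach_affine g : P g ->
  [/\ linear_part g (linpart g), linear (linpart g) &
      forall u v, '[linpart g u, linpart g v] = '[u, v]].
Proof. by move=> /(bieberbach_Iso bP)/isometry_affine. Qed.

Lemma bieberbach_linear_part g : P g -> linear_part g (linpart g).
Proof. by move=> /bieberbach_affine[]. Qed.

Lemma holonomyE (Q : set (E -> E)) : Q `<=` P ->
  holonomy Q = @linpart _ E @` Q.
Proof.
move=> QP; apply/seteqP; split=> [h [g Qg gh]|_ [g Qg <-]]; exists g => //.
  by rewrite (linear_part_unique gh).
exact/bieberbach_linear_part/QP.
Qed.

Lemma linpart_comp f g : P f -> P g -> linpart (f \o g) = linpart f \o linpart g.
Proof.
move=> /bieberbach_linear_part lf /bieberbach_linear_part lg.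
by rewrite -(linear_part_unique (linear_part_comp lf lg)).
Qed.

Lemma linpart_id : linpart (id : E -> E) = id.
Proof. by rewrite -(@linear_part_unique _ _ id id). Qed.

Lemma linpart_translate w : linpart (@translate _ E w) = id.
Proof. by rewrite -(linear_part_unique (@linear_part_translate _ _ w)). Qed.

Lemma translate_comp u v : @translate _ E (u + v) = translate u \o translate v.
Proof. by apply/funext => x; exact: translateD. Qed.

Lemma translate_id : @translate _ E 0 = id.
Proof. by apply/funext => x; exact: translate0. Qed.

Lemma linpart_eq_id g : P g ->
  (linpart g = id <-> exists2 v, L v & g = translate v).
Proof.
move=> Pg; split=> [gid|[v _ ->]]; last exact: linpart_translate.
have gE : g = translate (vec (origin E) (g (origin E))).
  apply/funext => x; have := bieberbach_linear_part Pg (vec (origin E) x) (origin E).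
  rewrite translate_vec gid => ->.
  rewrite -[X in translate _ X](translate_vec (origin E)) -translateD addrC translateD.
  by rewrite translate_vec.
by exists (vec (origin E) (g (origin E))); rewrite // /lattice /= -gE.
Qed.

Lemma lattice_group_law : group_law +%R 0 L.
Proof.
split; [exact: addrA|exact: add0r|exact: addr0| | |].
- by rewrite /lattice /= translate_id; exact: grp1 gP.
- by move=> u v Lu Lv; rewrite /lattice /= translate_comp; exact: grpM gP _ _ Lu Lv.
- move=> v Lv; exists (- v); last by rewrite subrr addNr.
  have [g Pg [vg gv]] := grpV gP Lv; rewrite /lattice /=.
  suff <- : g = translate (- v) by [].
  apply/funext => x.
  have vgx : translate v (g x) = x by have := congr1 (fun f => f x) vg.
  by rewrite -[in RHS]vgx -translateD addNr translate0.
Qed.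
Let gL := lattice_group_law.

Lemma holonomy_group_law : group_law (@compose V) id H.
Proof.
rewrite (holonomyE (@subset_refl _ P)); split=> //.
- by exists id; [exact: grp1 gP|exact: linpart_id].
- move=> _ _ [f Pf <-] [g Pg <-]; exists (f \o g); last exact: linpart_comp.
  exact: grpM gP _ _ Pf Pg.
- move=> _ [f Pf <-]; have [g Pg [fg gf]] := grpV gP Pf.
  exists (linpart g); first by exists g.
  by rewrite /compose -!linpart_comp// (fg : _ \o _ = _) (gf : _ \o _ = _) linpart_id.
Qed.

(** [image_comp] for the folded composition [compose]. *)
Lemma image_compose {T : Type} (f g : T -> T) (A : set T) :
  compose f g @` A = f @` (g @` A).
Proof. by rewrite image_comp. Qed.

Section Invariant.
Variable W : {vspace V}.
Hypothesis Winv : invariant_subspace H W.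

Lemma linpart_invariant g v : P g -> v \in W -> linpart g v \in W.
Proof.
by move=> Pg; apply: Winv; exists g => //; exact: bieberbach_linear_part.
Qed.

Lemma is_coset_image g F : P g -> is_coset W F -> is_coset W (g @` F).
Proof.
move=> Pg cF; have [x Fx] := is_coset_nonempty cF.
have [k Pk [gk kg]] := grpV gP Pg.
have kgE y : k (g y) = y by have := congr1 (fun f => f y) kg.
have gkE y : g (k y) = y by have := congr1 (fun f => f y) gk.
apply: (@is_cosetP _ _ _ _ (g x)); first by exists x.
move=> y; split=> [[z Fz <-]|Wy].
  rewrite (linear_part_vec _ _ (bieberbach_linear_part Pg)).
  exact/linpart_invariant/(is_coset_mem _ cF Fx).
exists (k y) => //; apply/(is_coset_mem _ cF Fx).
rewrite -(kgE x) (linear_part_vec _ _ (bieberbach_linear_part Pk)).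
exact: linpart_invariant.
Qed.

Lemma coset_kernel_normal : normal_in (@compose E) id P (coset_kernel P W).
Proof.
split.
- split=> //.
  + by split=> [|F _]; [exact: grp1 gP|exact: image_id].
  + move=> f g [Pf fF] [Pg gF]; split=> [|F cF]; first exact: grpM gP _ _ Pf Pg.
    by rewrite image_compose gF// fF.
  + move=> f [Pf fF]; have [g Pg [fg gf]] := grpV gP Pf; exists g => //.
    split=> // F cF; rewrite -{1}(fF F cF) -image_compose gf.
    exact: image_id.
- by move=> g [].
- move=> g n Pg [Pn nF]; have [k Pk [gk kg]] := grpV gP Pg.
  have gkE y : g (k y) = y by have := congr1 (fun f => f y) gk.
  exists (compose k (compose n g)).
    split=> [|F cF].
      by apply: (grpM gP) => //; exact: grpM gP _ _ Pn Pg.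
    rewrite (image_compose k) (image_compose n) nF; last exact: is_coset_image.
    by rewrite -image_compose kg image_id.
  by apply/funext => x; rewrite /compose /= gkE.
Qed.

Lemma lattice_inter_normal : normal_in +%R 0 L (L `&` [set v | v \in W]).
Proof.
split.
- split; [exact: addrA|exact: add0r|exact: addr0| | |].
  + by split; [exact: grp1 gL|exact: mem0v].
  + move=> u v [Lu Wu] [Lv Wv]; split; last exact: memvD.
    exact: grpM gL _ _ Lu Lv.
  + move=> v [Lv Wv]; exists (- v); last by rewrite subrr addNr.
    by split; [exact: group_law_opp | rewrite /= memvN].
- by move=> v [].
- by move=> u v _ Mv; exists v => //; rewrite addrC.
Qed.

Lemma coset_kernel_vec g x : coset_kernel P W g -> vec x (g x) \in W.
Proof.
move=> [_ gF]; have cF := is_coset_through W x.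
have : (g @` [set y | vec x y \in W]) (g x).
  by exists x => //=; rewrite vecxx mem0v.
by rewrite gF.
Qed.

Lemma coset_kernel_translate v : L v ->
  (coset_kernel P W (@translate _ E v) <-> v \in W).
Proof.
move=> Lv; split=> [/(coset_kernel_vec (origin E))|Wv].
  by rewrite vec_translate.
split=> // F cF; have [x Fx] := is_coset_nonempty cF.
apply: (is_coset_eq (x := translate v x) (is_coset_image (Lv : P _) cF) cF) => //.
by apply/(is_coset_mem _ cF Fx); rewrite vec_translate.
Qed.

(** [g] moves both endpoints [x] and [x + v] by vectors of [W]. *)
Lemma coset_kernel_linpart g v : coset_kernel P W g -> linpart g v - v \in W.
Proof.
move=> kg; have [Pg _] := kg; set o := origin E; set y := translate v o.
have -> : linpart g v - v = vec y (g y) - vec o (g o).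
  have gl := bieberbach_linear_part Pg.
  rewrite -(vec_translate v o) -/y -(linear_part_vec _ _ gl).
  rewrite -[vec (g o) (g y)](addKr (vec o (g o))) -vec_add (vec_add o y (g y)).
  by rewrite [vec o y + _]addrC addrA addrK addrC.
by rewrite memvB// coset_kernel_vec.
Qed.

(** Cosets are disjoint or equal, so mapping one point of [F] into [F] amounts to
    stabilizing [F]. *)
Lemma generic_coset_stab F g x : generic_coset P W F -> P g -> F x ->
  (F (g x) <-> coset_kernel P W g).
Proof.
move=> [cF genF] Pg Fx; split=> [Fgx|[_ gF]]; last first.
  by rewrite -[X in X (g x)](gF F cF); exists x.
rewrite -genF; split=> //.
by apply: (is_coset_eq (x := g x) (is_coset_image Pg cF) cF).
Qed.

End Invariant.

Section FiniteQuotients.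
Variable s : seq V.
Hypothesis sL : forall v, v \in s -> L v.
Hypothesis s_span : <<s>>%VS = fullv.

Lemma lattice_finite_bounded r : finite_set (L `&` [set v | '[v, v] <= r]).
Proof.
have [e e0 eP] := lattice_discrete bP.
apply: (finite_bounded e0) => // u v Lu Lv.
exact: grpM gL _ _ Lu (group_law_opp gL Lv).
Qed.

Lemma holonomy_lattice h v : H h -> L v -> L (h v).
Proof.
move=> [g Pg gh] Lv; have [k Pk [gk kg]] := grpV gP Pg.
rewrite /lattice /=; suff -> : translate (h v) = g \o (translate v \o k).
  by apply: (grpM gP) => //; exact: grpM gP _ _ Lv Pk.
have gkE y : g (k y) = y by have := congr1 (fun f => f y) gk.
by apply/funext => x /=; rewrite gh gkE.
Qed.

(** An element of the holonomy group is determined by the images of spanning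
    lattice vectors, which are lattice vectors of prescribed norm. *)
Lemma finite_holonomy : finite_set H.
Proof.
pose r := \sum_(v <- s) '[v, v].
have Hlin h : H h -> linear h /\ forall u, '[h u, h u] = '[u, u].
  rewrite (holonomyE (@subset_refl _ P)) => -[g Pg <-].
  by have [_ gl gi] := bieberbach_affine Pg.
apply: (@finite_inj _ _ _ (fun h : V -> V => map h s)).
  move=> f g /set_mem Hf /set_mem Hg /eq_in_map fg; apply/funext => v.
  have [fl _] := Hlin _ Hf; have [gl _] := Hlin _ Hg.
  by apply: (linear_span_eq fl gl fg); rewrite s_span memvf.
apply: sub_finite_set (finite_words (size s) (lattice_finite_bounded r)).
move=> _ [h Hh <-]; split; first by rewrite size_map.
move=> _ /mapP[v vs ->]; split; first by apply: holonomy_lattice => //; exact: sL.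
have [_ hi] := Hlin _ Hh; rewrite /= hi /r (big_rem v vs)/= lerDl.
by apply: sumr_ge0 => u _; exact: inner_ge0.
Qed.

(** Subtracting integral combinations of [s], every class has a representative
    all of whose coordinates with respect to [s] lie between 0 and 1. *)
Lemma finite_lattice_quotient (M : set V) : normal_in +%R 0 L M ->
  (forall v, v \in s -> M v) -> finite_set (quotient +%R L M).
Proof.
move=> nM sM; have gM := nrm_grp nM.
pose t := in_tuple s; pose S : R := \sum_(i < size s) \sum_(j < size s) `|'[t`_i, t`_j]|.
apply: sub_finite_set (finite_image (fun v => mulset +%R [set v] M)
  (lattice_finite_bounded S)) => _ [v Lv <-].
pose c i := coord t i v.
have vE : v = \sum_i c i *: t`_i by apply: coord_span; rewrite s_span memvf.
pose w := \sum_i (c i - (Num.floor (c i))%:~R) *: t`_i.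
have Mvw : M (v - w).
  rewrite vE -sumrB; apply: (big_ind M); [exact: grp1 gM | exact: grpM gM |].
  move=> i _; rewrite -scalerBl opprB addrC subrK scaler_int.
  by apply: group_law_mulrz => //; apply: sM; exact: mem_nth.
have /esym vwE : w + (v - w) = v by rewrite addrC subrK.
exists w; last by apply/(coset_eqP gL _ _ gM); exists (v - w).
split.
  have -> : w = v - (v - w) by rewrite opprB addrC subrK.
  exact: grpM gL _ _ Lv (group_law_opp gL (nrm_sub nM Mvw)).
rewrite /= -[leRHS]mul1r -(expr1n _ 2); apply: inner_coord_le => // i.
by rewrite ger0_norm ?subr_ge0 ?floor_le// lerBlDl ltW // -intrD1 floorD1_gt.
Qed.

End FiniteQuotients.

End Bieberbach.

(** * Two complementary invariant lattice subspaces *)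

Lemma cardfsX {T T' : choiceType} (A : {fset T}) (B : {fset T'}) :
  #|` (A `*` B)%fset| = (#|` A| * #|` B|)%N.
Proof.
rewrite -(size_allpairs pair); apply: perm_size; apply: uniq_perm.
- exact: fset_uniq.
- by apply: allpairs_uniq => // -[a b] [c d].
- move=> [a b]; rewrite in_fsetM /=; apply/andP/allpairsP => [[aA bB]|].
    by exists (a, b).
  by move=> [[c d] /= [cA dB [-> ->]]].
Qed.

Section Complementary.
Context {R : realType} (E : euclideanAffine R) (P : set (E -> E)).
Hypothesis bP : bieberbach P.
Local Notation V := (tvect E).
Local Notation L := (lattice P).
Local Notation H := (holonomy P).
Implicit Types (x y z : E) (u v w : V).

(** [linpart g v - v] lies in [W], and also in the invariant subspace [W']. *)
Lemma coset_kernel_linpart_fix (W W' : {vspace V}) g v :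
  invariant_subspace H W' -> (W :&: W')%VS = 0%VS ->
  coset_kernel P W g -> v \in W' -> linpart g v = v.
Proof.
move=> W'inv W0 kg W'v; apply/eqP; rewrite -subr_eq0 -memv0 -W0 memv_cap.
rewrite (coset_kernel_linpart bP) // memvB //.
by apply: (linpart_invariant bP W'inv) => //; case: kg.
Qed.

Variables V1 V2 : {vspace V}.
Hypothesis V1inv : invariant_subspace H V1.
Hypothesis V2inv : invariant_subspace H V2.
Hypothesis V12D : (V1 + V2)%VS = fullv.
Hypothesis V12I : (V1 :&: V2)%VS = 0%VS.

Local Notation P1 := (coset_kernel P V1).
Local Notation P2 := (coset_kernel P V2).
Local Notation L1 := (L `&` [set v | v \in V1]).
Local Notation L2 := (L `&` [set v | v \in V2]).

(** If a product [k1 k2] is a translation, the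
    linear part of [k1] is the identity on [V2], and on [V1] as the inverse of the
    linear part of [k2], so that [k1] and [k2] are translations themselves. *)
Lemma coset_kernels_lattice v : L v ->
  (mulset (@compose E) P1 P2 (@translate _ E v) <-> mulset +%R L1 L2 v).
Proof.
move=> Lv; split; last first.
  move=> [v1 [Lv1 V1v1] [v2 [Lv2 V2v2] <-]].
  exists (translate v1); first exact/(coset_kernel_translate bP V1inv Lv1).
  exists (translate v2); first exact/(coset_kernel_translate bP V2inv Lv2).
  by rewrite translate_comp.
move=> [k1 K1 [k2 K2 k12]]; have [Pk1 _] := K1; have [Pk2 _] := K2.
have h12 u : linpart k1 (linpart k2 u) = u.
  have := linpart_comp bP Pk1 Pk2; rewrite [_ \o _]k12 linpart_translate.
  by move=> /(congr1 (fun f => f u)).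
have h1V2 u : u \in V2 -> linpart k1 u = u.
  exact: (coset_kernel_linpart_fix V2inv V12I K1).
have h1V1 u : u \in V1 -> linpart k1 u = u.
  move=> V1u; rewrite -{1}(_ : linpart k2 u = u) //.
  by apply: (coset_kernel_linpart_fix V1inv _ K2) => //; rewrite capvC.
have h1id : linpart k1 = id.
  apply/funext => u; have : u \in (V1 + V2)%VS by rewrite V12D memvf.
  case/memv_addP => u1 V1u1 [u2 V2u2 ->].
  have [_ hl _] := bieberbach_affine bP Pk1.
  by rewrite -[u1]scale1r hl !scale1r h1V1 // h1V2.
have h2id : linpart k2 = id by apply/funext => u; rewrite -[RHS]h12 h1id.
have /(linpart_eq_id bP Pk1)[w1 Lw1 k1E] := h1id.
have /(linpart_eq_id bP Pk2)[w2 Lw2 k2E] := h2id.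
rewrite k1E in K1 k12; rewrite k2E in K2 k12.
exists w1.
  by split=> //; exact/(coset_kernel_translate bP V1inv Lw1).
exists w2.
  by split=> //; exact/(coset_kernel_translate bP V2inv Lw2).
apply: (@translate_inj _ _ (origin E)) => /=.
by rewrite translateD; exact: (congr1 (fun f => f (origin E)) k12).
Qed.

Lemma cosets_meet_image F1 F2 g : is_coset V1 F1 -> is_coset V2 F2 -> P g ->
  exists y, F1 `&` g @` F2 = [set y].
Proof.
by move=> c1 c2 Pg; exact: (cosets_meet V12D V12I c1 (is_coset_image bP V2inv Pg c2)).
Qed.

Lemma coset_lattice_stab (W : {vspace V}) F v x : is_coset W F -> L v -> F x ->
  (F (translate v x) <-> (L `&` [set v | v \in W]) v).
Proof.
move=> cF Lv Fx; split=> [/(is_coset_mem _ cF Fx)|[_ Wv]].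
  by rewrite vec_translate.
by apply/(is_coset_mem _ cF Fx); rewrite vec_translate.
Qed.

Lemma prTE x : prT L x = [set translate v x | v in L].
Proof.
apply/seteqP; split=> [_ [_ [v Lv <-] <-]|_ [v Lv <-]]; first by exists v.
by exists (translate v) => //; exists v.
Qed.

Local Notation N := (mulset (@compose E) P1 P2).
Local Notation L12 := (mulset +%R L1 L2).
Local Notation Phat := (quotient (@compose E) P N).
Local Notation Lhat := (quotient +%R L L12).
Local Notation app := (fun (g : E -> E) (x : E) => g x).
Local Notation trans := (@translate _ E).

Let gP := bieberbach_group_law bP.
Let gL := lattice_group_law bP.
Let nP1 := coset_kernel_normal bP V1inv.
Let nP2 := coset_kernel_normal bP V2inv.
Let nL1 := lattice_inter_normal bP V1.
Let nL2 := lattice_inter_normal bP V2.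
Let nN := mulset_normal gP nP1 nP2.
Let nL12 := mulset_normal gL nL1 nL2.
Let transD : forall u v, trans (u + v) = compose (trans u) (trans v) :=
  @translate_comp _ E.

(** A translation that maps a point of a coset of [W] into the coset has its vector
    in [W], so here the two cosets are arbitrary. *)
Lemma torus_meet_bij F1 F2 : is_coset V1 F1 -> is_coset V2 F2 ->
  set_bij Lhat ((prT L @` F1) `&` (prT L @` F2)) (meet_orbit L trans F1 F2).
Proof.
move=> c1 c2.
have := @meet_orbit_bij _ _ +%R 0 L trans F1 F2 L1 L2 gL (@translate0 _ E)
  (@translateD _ E) nL1 nL2.
have -> : prT L = fun x => [set translate v x | v in L].
  by apply/funext => x; exact: prTE.
apply=> [v x Lv Fx|v x Lv Fx|v Lv].
- exact: coset_lattice_stab.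
- exact: coset_lattice_stab.
- exact: cosets_meet_image.
Qed.

Variables E1 E2 : set E.
Hypothesis E1gen : generic_coset P V1 E1.
Hypothesis E2gen : generic_coset P V2 E2.

Lemma manifold_meet_bij :
  set_bij Phat ((pr P @` E1) `&` (pr P @` E2)) (meet_orbit P app E1 E2).
Proof.
apply: (@meet_orbit_bij _ _ (@compose E) id P app E1 E2 P1 P2 gP) => //.
- by move=> g x Pg; exact: (generic_coset_stab bP).
- by move=> g x Pg; exact: (generic_coset_stab bP).
- by move=> g Pg; apply: cosets_meet_image => //; [case: E1gen|case: E2gen].
Qed.

Lemma torus_to_manifold_pr y : torus_to_manifold P (prT L y) = pr P y.
Proof.
rewrite prTE; apply/seteqP; split.
  move=> z [_ [v Lv <-] [g Pg <-]]; exists (g \o translate v) => //.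
  exact: grpM gP _ _ Pg Lv.
by move=> z oz; exists y => //; exists 0; [exact: grp1 gL|rewrite translate0].
Qed.

(** For [v] in [L] both bijections send the class of [v] to the orbit, under
    the respective group, of the common point of [E1] and [translate v @` E2]. *)
Lemma torus_to_manifold_meet C : Lhat C ->
  torus_to_manifold P (meet_orbit L trans E1 E2 C) =
  meet_orbit P app E1 E2 (induced N C).
Proof.
have [c1 _] := E1gen; have [c2 _] := E2gen.
move=> [v Lv <-]; have [y my] := cosets_meet_image c1 c2 Lv.
have [E1y [b E2b yE]] : (E1 `&` translate v @` E2) y by rewrite my.
rewrite -yE in E1y.
have -> : induced N (mulset +%R [set v] L12) = mulset (@compose E) [set trans v] N.
  exact: (induced_cosetE gL gP nL12 nN transD coset_kernels_lattice Lv).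
rewrite (@meet_orbitE _ _ +%R 0 L trans E1 E2 L1 L2 gL (@translate0 _ E)
  (@translateD _ E) nL1 nL2 _ _ _ v b) //; last 3 first.
- by move=> u x Lu Ex; exact: coset_lattice_stab.
- by move=> u x Lu Ex; exact: coset_lattice_stab.
- by move=> u Lu; exact: cosets_meet_image.
rewrite (@meet_orbitE _ _ (@compose E) id P app E1 E2 P1 P2 gP _
  _ nP1 nP2 _ _ _ (trans v) b) //; last 3 first.
- by move=> g x Pg; exact: (generic_coset_stab bP).
- by move=> g x Pg; exact: (generic_coset_stab bP).
- by move=> g Pg; exact: cosets_meet_image.
by rewrite -prTE torus_to_manifold_pr.
Qed.

Lemma induced_sub : induced N @` Lhat `<=` Phat.
Proof.
exact: (induced_coset_sub gL gP nL12 nN transD _ coset_kernels_lattice).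
Qed.

Lemma induced_morph :
  {in Lhat &, {morph induced N : A B / mulset +%R A B >-> mulset (@compose E) A B}}.
Proof.
exact: (induced_coset_morph gL gP nL12 nN transD _ coset_kernels_lattice).
Qed.

Lemma induced_inj : set_inj Lhat (induced N).
Proof.
exact: (induced_coset_inj gL gP nL12 nN transD _ coset_kernels_lattice).
Qed.

Lemma holonomy_mulset : @linpart _ E @` N =
  mulset (@compose V) (holonomy P1) (holonomy P2).
Proof.
have s1 : P1 `<=` P by move=> g [].
have s2 : P2 `<=` P by move=> g [].
rewrite !(holonomyE bP)//; apply/seteqP; split.
  move=> _ [_ [f Ff [g Gg <-]] <-]; exists (linpart f); first by exists f.
  exists (linpart g); first by exists g.
  by rewrite [RHS](linpart_comp bP (s1 _ Ff) (s2 _ Gg)).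
move=> _ [_ [f Ff <-] [_ [g Gg <-] <-]]; exists (compose f g).
  by exists f => //; exists g.
exact: (linpart_comp bP (s1 _ Ff) (s2 _ Gg)).
Qed.

(** [P / (P1 P2)] is an extension of [H / (H1 H2)] by [L / (L1 L2)], because the
    elements of [P] with trivial linear part are the translations by [L]. *)
Lemma holonomy_extension :
  exists phi, set_bij (Lhat `*` quotient (@compose V) H
    (mulset (@compose V) (holonomy P1) (holonomy P2))) Phat phi.
Proof.
rewrite -holonomy_mulset.
apply: (quotient_extension gL gP (holonomy_group_law bP) nL12 nN transD _
  coset_kernels_lattice).
- by [].
- by move=> f g Pf Pg; exact: (linpart_comp bP).
- by rewrite (holonomyE bP).
- by move=> g Pg; exact: (linpart_eq_id bP).
Qed.

End Complementary.

Theorem theorem4 (R : realType) (E : euclideanAffine R)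
    (dimE : (2 <= \dim {:tvect E})%N)
    (P : set (E -> E)) (bP : bieberbach P)
    (V1 V2 : {vspace tvect E})
    (V1_neq0 : V1 != 0%VS) (V1_proper : V1 != fullv)
    (V2_neq0 : V2 != 0%VS) (V2_proper : V2 != fullv)
    (V1_inv : invariant_subspace (holonomy P) V1)
    (V2_inv : invariant_subspace (holonomy P) V2)
    (V1_lat : lattice_subspace (lattice P) V1)
    (V2_lat : lattice_subspace (lattice P) V2)
    (V1V2_full : (V1 + V2)%VS = fullv) (V1V2_cap : (V1 :&: V2)%VS = 0%VS)
    (E1 E2 : set E)
    (E1_gen : generic_coset P V1 E1) (E2_gen : generic_coset P V2 E2) :
  let L := lattice P in
  let H := holonomy P in
  let P1 := coset_kernel P V1 in
  let P2 := coset_kernel P V2 in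
  let L1 := L `&` [set v | v \in V1] in
  let L2 := L `&` [set v | v \in V2] in
  let H1 := holonomy P1 in
  let H2 := holonomy P2 in
  let K1 := orth_fixing H V1 in
  let K2 := orth_fixing H V2 in
  let Phat := quotient compose P (mulset compose P1 P2) in
  let Lhat := quotient +%R L (mulset +%R L1 L2) in
  let Hhat := quotient compose H (mulset compose H1 H2) in
  let M12 := (pr P @` E1) `&` (pr P @` E2) in
  let T12 := (prT L @` E1) `&` (prT L @` E2) in
  [/\ (* (a) *)
      [/\ finite_set M12, finite_set T12, M12 #= Phat & T12 #= Lhat],
      (* (b) *)
      torus_to_manifold P @` T12 `<=` M12 /\
      set_inj T12 (torus_to_manifold P),
      (* (c) *)
      [/\ finite_set Hhat,
          #|` fset_set M12| = (#|` fset_set T12| * #|` fset_set Hhat|)%N &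
          H1 = K1 -> H2 = K2 ->
          #|` fset_set M12| =
          (#|` fset_set T12| *
           #|` fset_set (quotient compose H (mulset compose K1 K2))|)%N],
      (* (d) *)
      forall F1 F2 : set E, is_coset V1 F1 -> is_coset V2 F2 ->
        let T12' := (prT L @` F1) `&` (prT L @` F2) in
        finite_set T12' /\ T12' #= Lhat
    & (* (e) *)
      let iota := induced (mulset compose P1 P2) in
      [/\ iota @` Lhat `<=` Phat,
          {in Lhat &, {morph iota : A B / mulset +%R A B >-> mulset compose A B}}
        & exists (f : set (E -> E) -> set E) (g : set (tvect E) -> set E),
            [/\ set_bij Phat M12 f, set_bij Lhat T12 g &
                {in Lhat, forall C, torus_to_manifold P (g C) = f (iota C)}]]].
Proof.
move=> L H P1 P2 L1 L2 H1 H2 K1 K2 Phat Lhat Hhat M12 T12.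
have [c1 _] := E1_gen; have [c2 _] := E2_gen.
have [s1 s1P s1V1] := V1_lat; have [s2 s2P s2V2] := V2_lat.
pose s := s1 ++ s2.
have sL v : v \in s -> L v by rewrite mem_cat => /orP[/s1P[]|/s2P[]].
have s_span : <<s>>%VS = fullv by rewrite span_cat s1V1 s2V2.
have gL := lattice_group_law bP.
have nL1 := lattice_inter_normal bP V1; have nL2 := lattice_inter_normal bP V2.
have finL : finite_set Lhat.
  apply: (finite_lattice_quotient bP s_span (mulset_normal gL nL1 nL2)) => v.
  rewrite mem_cat => /orP[/s1P Lv|/s2P Lv].
    exists v => //; exists 0; last exact: addr0.
    exact: grp1 (nrm_grp nL2).
  exists 0; first exact: grp1 (nrm_grp nL1).
  by exists v => //; exact: add0r.
have finHhat : finite_set Hhat.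
  exact: finite_image (finite_holonomy bP sL s_span).
have fbij := manifold_meet_bij bP V1_inv V2_inv V1V2_full V1V2_cap E1_gen E2_gen.
have tbij F1 F2 := torus_meet_bij bP V2_inv V1V2_full V1V2_cap (F1 := F1) (F2 := F2).
have fgE := torus_to_manifold_meet bP V1_inv V2_inv V1V2_full V1V2_cap E1_gen E2_gen.
have iotaP := induced_sub bP V1_inv V2_inv V1V2_full V1V2_cap.
have iota_inj := induced_inj bP V1_inv V2_inv V1V2_full V1V2_cap.
have [phi phibij] := holonomy_extension bP V1_inv V2_inv V1V2_full V1V2_cap.
set f := meet_orbit P _ E1 E2 in fbij fgE.
have gbij := tbij _ _ c1 c2; set g := meet_orbit _ _ E1 E2 in gbij fgE.
have M12P : M12 #= Phat by rewrite card_eq_sym; apply/card_set_bijP; exists f.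
have PLH : Phat #= (Lhat `*` Hhat).
  by rewrite card_eq_sym; apply/card_set_bijP; exists phi.
have finPhat : finite_set Phat by rewrite (eq_finite_set PLH); exact: finite_setX.
have finM12 : finite_set M12 by rewrite (eq_finite_set M12P).
have torusP F1 F2 : is_coset V1 F1 -> is_coset V2 F2 ->
    finite_set ((prT L @` F1) `&` (prT L @` F2)) /\
    (prT L @` F1) `&` (prT L @` F2) #= Lhat.
  move=> cF1 cF2.
  have TL : (prT L @` F1) `&` (prT L @` F2) #= Lhat.
    rewrite card_eq_sym; apply/card_set_bijP.
    by exists (meet_orbit L (@translate _ E) F1 F2); exact: tbij.
  by split=> //; rewrite (eq_finite_set TL).
have [finT12 T12L] := torusP _ _ c1 c2.
have card_M12 : #|` fset_set M12| = (#|` fset_set T12| * #|` fset_set Hhat|)%N.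
  have -> : #|` fset_set T12| = #|` fset_set Lhat| by apply/fcard_eq.
  rewrite -cardfsX -fset_setX //; apply/fcard_eq => //.
    exact: finite_setX.
  exact: card_eq_trans M12P PLH.
have [f_sub f_inj _] := fbij; have [g_sub g_inj g_surj] := gbij.
split.
- by split.
- split.
    move=> _ [_ /g_surj[C qC <-] <-]; rewrite fgE //; apply: f_sub.
    by apply: iotaP; exists C.
  move=> t t' /set_mem/g_surj[C qC <-] /set_mem/g_surj[C' qC' <-].
  rewrite !fgE // => eq_f; congr (g _).
  apply: iota_inj; [exact: mem_set|exact: mem_set|].
  by apply: f_inj eq_f; apply/mem_set/iotaP; [exists C|exists C'].
- by split=> // H1K1 H2K2; rewrite card_M12 -/K1 -/K2 -H1K1 -H2K2.
- by move=> F1 F2 cF1 cF2; exact: torusP.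
- split=> //.
    exact: (induced_morph bP V1_inv V2_inv V1V2_full V1V2_cap).
  by exists f, g; split=> // C /set_mem qC; exact: fgE.
Qed.
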